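(* The Lorentzian Lie algebra $(\mathfrak g_4,S,J)$ is flat with respect to the canonical connection $\nabla^0$, i.e. $R^0_{uv}w=0$ for all $u,v,w\in\mathfrak g_4$.
   Context: $\mathfrak g_4$ is the real Lie algebra with basis $e_1,e_2,e_3,e_4$ and non-zero brackets (up to skew-symmetry) $[e_1,e_2]=e_3$, $[e_1,e_3]=e_4$. $S$ is the Lorentzian inner product $\langle\cdot,\cdot\rangle$ on $\mathfrak g_4$ whose matrix in $(e_1,e_2,e_3,e_4)$ is $\begin{bmatrix}1&0&0&0\\0&0&0&-1\\0&0&1&0\\0&-1&0&0\end{bmatrix}$. Fix the basis $v_1=e_1$, $v_2=e_3$, $v_3=\frac1{\sqrt2}(e_2-e_4)$, $v_4=\frac1{\sqrt2}(e_2+e_4)$, which is orthonormal: $\langle v_i,v_j\rangle=0$ for $i\ne j$, $\langle v_i,v_i\rangle=1$ for $i=1,2,3$, $\langle v_4,v_4\rangle=-1$. The product structure $J$ is the linear map with $Jv_i=v_i$ for $i=1,2,3$ and $Jv_4=-v_4$. Write $\mathfrak g$ for the Lie algebra. The Levi-Civita connection is the bilinear map $\nabla:\mathfrak g\times\mathfrak g\to\mathfrak g$ with $2\langle\nabla_uv,w\rangle=\langle[u,v],w\rangle+\langle[w,u],v\rangle+\langle[w,v],u\rangle$ for all $u,v,w$. Put $(\nabla_uJ)v=\nabla_u(Jv)-J(\nabla_uv)$. The canonical connection is $\nabla^0_uv=\nabla_uv-\frac12(\nabla_uJ)Jv$, and its curvature is $R^0_{uv}w=\nabla^0_{[u,v]}w-\nabla^0_u\nabla^0_vw+\nabla^0_v\nabla^0_uw$.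 *)

(* Defs.v *)
From HB Require Import structures.
From mathcomp Require Import all_boot all_order all_algebra.
From mathcomp Require Import reals.
From mathcomp Require Import ring lra.

Set Implicit Arguments.
Unset Strict Implicit.
Unset Printing Implicit Defensive.

Import Order.TTheory GRing.Theory Num.Theory.
Local Open Scope ring_scope.

Definition is_lie_bracket (R : realType) (V : lmodType R) (br : V -> V -> V) :=
  [/\ bilinear_for *:%R *:%R br,
      forall u, br u u = 0 &
      forall u v w, br u (br v w) + br v (br w u) + br w (br u v) = 0].

Section Connections.
Context (R : realType) (V : lmodType R).
Implicit Types (br nabla : V -> V -> V) (ip : V -> V -> R) (J : V -> V).

(* The Koszul identity on left-invariant fields. When ip is nondegenerate it
   determines nabla, the Levi-Civita connection. *)
Definition is_levi_civita br ip nabla :=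
  forall u v w, 2 * ip (nabla u v) w
    = ip (br u v) w + ip (br w u) v + ip (br w v) u.

Definition cov_deriv_op nabla J (u v : V) : V := nabla u (J v) - J (nabla u v).

Definition canonical_connection nabla J (u v : V) : V :=
  nabla u v - 2^-1 *: cov_deriv_op nabla J u (J v).

(* Mind the sign: this is the opposite of [D_u, D_v] - D_[u,v]. *)
Definition curvature br (D : V -> V -> V) (u v w : V) : V :=
  D (br u v) w - D u (D v w) + D v (D u w).

Definition is_flat br (D : V -> V -> V) :=
  forall u v w, curvature br D u v w = 0.

End Connections.

(* The underlying space of g_4 is 'rV[R]_4; e_1, ..., e_4 form the canonical
   basis, which is indexed from 0 by 'I_4. *)

Section G4.
Context {R : realType}.
Local Notation V := 'rV[R]_4.
Implicit Types u v w : V.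

Definition g4_e1 : V := 'e_(0 : 'I_4).
Definition g4_e2 : V := 'e_(1 : 'I_4).
Definition g4_e3 : V := 'e_(2 : 'I_4).
Definition g4_e4 : V := 'e_(3 : 'I_4).

(* Bilinear alternating extension of [e1, e2] = e3 and [e1, e3] = e4. *)
Definition g4_bracket (u v : V) : V :=
  (u 0 0 * v 0 1 - u 0 1 * v 0 0) *: g4_e3
  + (u 0 0 * v 0 2 - u 0 2 * v 0 0) *: g4_e4.

Definition g4_S : 'M[R]_4 :=
  \matrix_(i, j) nth 0 (nth [::] [:: [:: 1;  0; 0;  0];
                                     [:: 0;  0; 0; -1];
                                     [:: 0;  0; 1;  0];
                                     [:: 0; -1; 0;  0]] i) j.

(* With theta := idfun, form is bilinear: it is u *m g4_S *m v^T. *)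
Definition g4_inner (u v : V) : R := form idfun g4_S u v.

Definition g4_v1 : V := g4_e1.
Definition g4_v2 : V := g4_e3.
Definition g4_v3 : V := (Num.sqrt 2)^-1 *: (g4_e2 - g4_e4).
Definition g4_v4 : V := (Num.sqrt 2)^-1 *: (g4_e2 + g4_e4).

Definition is_g4_product_structure (J : V -> V) :=
  [/\ J g4_v1 = g4_v1, J g4_v2 = g4_v2, J g4_v3 = g4_v3 & J g4_v4 = - g4_v4].

Lemma row4P u v :
  [/\ u 0 0 = v 0 0, u 0 1 = v 0 1, u 0 2 = v 0 2 & u 0 3 = v 0 3] -> u = v.
Proof.
case=> h0 h1 h2 h3; apply/rowP => -[[|[|[|[|//]]]] p].
- by rewrite (_ : Ordinal p = 0) //; apply/val_inj.
- by rewrite (_ : Ordinal p = 1) //; apply/val_inj.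
- by rewrite (_ : Ordinal p = 2) //; apply/val_inj.
- by rewrite (_ : Ordinal p = 3) //; apply/val_inj.
Qed.

Lemma g4_innerE u v :
  g4_inner u v = u 0 0 * v 0 0 - u 0 1 * v 0 3 + u 0 2 * v 0 2 - u 0 3 * v 0 1.
Proof.
have o1 : lift ord0 ord0 = 1 :> 'I_4 by apply/val_inj.
have o2 : lift ord0 (lift ord0 ord0) = 2 :> 'I_4 by apply/val_inj.
have o3 : lift ord0 (lift ord0 (lift ord0 ord0)) = 3 :> 'I_4 by apply/val_inj.
have o0 : ord0 = 0 :> 'I_4 by apply/val_inj.
rewrite /g4_inner /form !mxE !big_ord_recl big_ord0 !mxE.
rewrite !big_ord_recl !big_ord0 !mxE /= !o1 !o2 !o3 !o0; ring.
Qed.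

Lemma g4_bracket_table :
  [/\ g4_bracket g4_e1 g4_e2 = g4_e3, g4_bracket g4_e1 g4_e3 = g4_e4,
      g4_bracket g4_e1 g4_e4 = 0 &
      [/\ g4_bracket g4_e2 g4_e3 = 0, g4_bracket g4_e2 g4_e4 = 0 &
          g4_bracket g4_e3 g4_e4 = 0]].
Proof. by split; [| | |split]; apply: row4P; split; rewrite !mxE /=; ring. Qed.

Lemma g4_is_lie : is_lie_bracket g4_bracket.
Proof.
split; [split=> [v a u u'|u a v v'] | move=> u | move=> u v w];
  by apply: row4P; split; rewrite !mxE /=; ring.
Qed.

Lemma g4_v_orthonormal :
  [/\ g4_inner g4_v1 g4_v1 = 1, g4_inner g4_v2 g4_v2 = 1,
      g4_inner g4_v3 g4_v3 = 1 & g4_inner g4_v4 g4_v4 = -1] /\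
  [/\ g4_inner g4_v1 g4_v2 = 0, g4_inner g4_v1 g4_v3 = 0,
      g4_inner g4_v1 g4_v4 = 0 &
      [/\ g4_inner g4_v2 g4_v3 = 0, g4_inner g4_v2 g4_v4 = 0 &
          g4_inner g4_v3 g4_v4 = 0]].
Proof.
have : 2 * (Num.sqrt 2)^-1 ^+ 2 = 1 :> R.
  by rewrite exprVn sqr_sqrtr ?ler0n // divff ?pnatr_eq0.
rewrite /g4_v3 /g4_v4; move: (Num.sqrt 2)^-1 => s s2.
split.
  split; rewrite g4_innerE !mxE /= ?mulr0 ?mulr1; lra.
by split; last split; rewrite g4_innerE !mxE /=; lra.
Qed.

Lemma g4_levi_civita_unique (nabla nabla' : V -> V -> V) :
  is_levi_civita g4_bracket g4_inner nabla ->
  is_levi_civita g4_bracket g4_inner nabla' -> nabla =2 nabla'.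
Proof.
move=> h h' u v.
have e w : g4_inner (nabla u v) w = g4_inner (nabla' u v) w.
  by apply: (@mulfI _ 2); rewrite ?pnatr_eq0 // h h'.
move: (e g4_e1) (e g4_e2) (e g4_e3) (e g4_e4); rewrite !g4_innerE !mxE /=.
by move=> a b c d; apply: row4P; split; lra.
Qed.

Lemma g4_levi_civita_exists : exists nabla : {bilinear V -> V -> V},
  is_levi_civita g4_bracket g4_inner nabla.
Proof.
pose D u v : V := (u 0 0 * v 0 1) *: g4_e3 + (u 0 0 * v 0 2) *: g4_e4.
have Dbil : bilinear_for *:%R *:%R D.
  by split=> [v a u u'|u a v v']; apply: row4P; split; rewrite !mxE /=; ring.
pose M := bilinear_isBilinear.Build R V V V *:%R *:%R D Dbil.
pose N : {bilinear V -> V -> V} := HB.pack D M.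
by exists N => u v w; rewrite !g4_innerE !mxE /=; ring.
Qed.

Lemma g4_product_structure_exists :
  exists J : {linear V -> V}, is_g4_product_structure J.
Proof.
pose J u : V := u 0 0 *: g4_e1 - u 0 3 *: g4_e2 + u 0 2 *: g4_e3
  - u 0 1 *: g4_e4.
have Jlin : linear J.
  by move=> a u v; apply: row4P; split; rewrite !mxE /=; ring.
pose L := GRing.isLinear.Build R V V *:%R J Jlin.
pose F : {linear V -> V} := HB.pack J L.
by exists F; split; apply: row4P; split; rewrite !mxE /=; ring.
Qed.

Lemma g4_product_structure_unique (J J' : {linear V -> V}) :
  is_g4_product_structure J -> is_g4_product_structure J' -> J =1 J'.
Proof.
move=> [a1 a2 a3 a4] [b1 b2 b3 b4] u.
have s0 : Num.sqrt 2 != 0 :> R by rewrite gt_eqF // sqrtr_gt0 ltr0n.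
set s : R := Num.sqrt 2 in s0 *.
have -> : u = u 0 0 *: g4_v1 + u 0 2 *: g4_v2
    + (s / 2 * (u 0 1 - u 0 3)) *: g4_v3 + (s / 2 * (u 0 1 + u 0 3)) *: g4_v4.
  by apply: row4P; split; rewrite !mxE /= -/s; field.
move: g4_v1 g4_v2 g4_v3 g4_v4 a1 a2 a3 a4 b1 b2 b3 b4.
by move=> v1 v2 v3 v4 a1 a2 a3 a4 b1 b2 b3 b4;
  rewrite !linearD !linearZ /= a1 a2 a3 a4 b1 b2 b3 b4.
Qed.

End G4.

(* Main.v *)
Require Import Defs.
From mathcomp Require Import all_boot all_order all_algebra.
From mathcomp Require Import reals.
From mathcomp Require Import lra.

Set Implicit Arguments.
Unset Strict Implicit.
Unset Printing Implicit Defensive.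

Import GRing.Theory.
Local Open Scope ring_scope.

(* The Levi-Civita connection of (g_4, S) has the form nabla_u = e^1(u) A, where
   e^1 is the first coordinate and A = nabla_(e_1). This form is inherited by
   the canonical connection: nabla^0_u = e^1(u) B for a fixed linear map B.
   Hence all the operators nabla^0_u commute, and nabla^0_[u,v] = 0 because
   brackets have no e_1-component. *)

(** Both second-order terms equal [(f u * f v) *: B (B w)], with opposite signs. *)
Lemma flat_of_rank_one (R : realType) (V : lmodType R) (br D : V -> V -> V)
    (f : V -> R) (B : V -> V) :
  (forall u v, f (br u v) = 0) -> (forall u v, D u v = f u *: B v) ->
  scalable B -> is_flat br D.
Proof.
move=> f_br DE BZ u v w.
by rewrite /curvature !DE f_br !BZ !scalerA mulrC scale0r add0r addNr.
Qed.

(** Here B = A - 1/2 (A J - J A) J, written through the constant family [fun=> A]; its argument [0]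
    is a placeholder. *)
Lemma canonical_connection_rank_one (R : realType) (V : lmodType R)
    (nabla : V -> V -> V) (J : {linear V -> V}) (f : V -> R) (A : V -> V) :
  (forall u v, nabla u v = f u *: A v) ->
  forall u v, canonical_connection nabla J u v
    = f u *: canonical_connection (fun=> A) J 0 v.
Proof.
move=> nablaE u v.
rewrite /canonical_connection /cov_deriv_op !nablaE (linearZ_LR J).
by rewrite -scalerBr scalerA mulrC -scalerA -scalerBr.
Qed.

Lemma g4_levi_civita_rank_one (R : realType)
    (nabla : 'rV[R]_4 -> 'rV[R]_4 -> 'rV[R]_4) :
  is_levi_civita g4_bracket g4_inner nabla ->
  forall u v, nabla u v = u 0 0 *: nabla g4_e1 v.
Proof.
move=> nablaP.
have nablaE u v :
    nabla u v = u 0 0 *: (v 0 1 *: g4_e3 + v 0 2 *: g4_e4).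
  (* Pairing with e_1, e_2, e_3, e_4 reads off coordinates 1, 4, 3, 2 up to sign. *)
  move: (nablaP u v g4_e1) (nablaP u v g4_e2) (nablaP u v g4_e3)
    (nablaP u v g4_e4); rewrite !g4_innerE !mxE /= => h1 h2 h3 h4.
  by apply: row4P; split; rewrite !mxE /=; lra.
by move=> u v; rewrite !nablaE mxE /= scale1r.
Qed.

Theorem theorem3p29 (R : realType)
    (nabla : {bilinear 'rV[R]_4 -> 'rV[R]_4 -> 'rV[R]_4})
    (J : {linear 'rV[R]_4 -> 'rV[R]_4}) :
  is_levi_civita g4_bracket g4_inner nabla ->
  is_g4_product_structure J ->
  is_flat g4_bracket (canonical_connection nabla J).
Proof.
move=> nablaP _.
have DE := canonical_connection_rank_one J (g4_levi_civita_rank_one nablaP).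
apply: flat_of_rank_one DE _ => [u v | a v].
  by rewrite !mxE /= !mulr0 addr0.
(* B is homogeneous since [nabla g4_e1] and [J] are. *)
rewrite /canonical_connection /cov_deriv_op !(linearZ_LR J, linearZr_LR).
by rewrite -scalerBr scalerA mulrC -scalerA -scalerBr.
Qed.
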